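(* (i) If $n$ is odd, then $N_3(n)\ge\frac12\binom{n}{3}$. (ii) If $n$ is even, then $N_3(n)\ge\frac18\binom{n-2}{3}$. (iii) $N_3(n)\le\left(\frac56+o(1)\right)\binom{n}{3}$ as $n\to\infty$.
   Context: There are $n$ balls, each colored red or blue in an unknown way. A ball $b$ is a non-minority ball of the set of all balls if at least $n/2$ balls have the color of $b$. A query is a set of three balls, and the answer is (the index of) a majority ball of the triple, i.e. a ball whose color is shared by another ball of the triple, chosen adversarially. $N_3(n)$ is the minimum size of a non-adaptive query set (all triples fixed in advance) which determines a non-minority ball, meaning that for every coloring and every admissible sequence of answers, some ball is a non-minority ball of the whole set in every coloring consistent with the answers. *)

(* Defs.v *)
From mathcomp Require Import all_boot.

Set Implicit Arguments.
Unset Strict Implicit.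
Unset Printing Implicit Defensive.

Definition coloring (n : nat) := {ffun 'I_n -> bool}.

Definition non_minority (n : nat) (c : coloring n) (b : 'I_n) : bool :=
  n <= 2 * #|[set x | c x == c b]|.

Definition majority_ball (n : nat) (c : coloring n) (T : {set 'I_n})
    (b : 'I_n) : bool :=
  (b \in T) && [exists x in T, (x != b) && (c x == c b)].

Definition query_set (n : nat) (Q : {set {set 'I_n}}) : bool :=
  [forall T in Q, #|T| == 3].

(* Only the values of an answer function on the triples of the query set
   matter; [consistent] ignores the others.  There is no answer function for
   n = 0, where [N3 0 = 0] by convention. *)
Definition answers (n : nat) := {ffun {set 'I_n} -> 'I_n}.

Definition consistent (n : nat) (Q : {set {set 'I_n}}) (a : answers n)
    (c : coloring n) : bool :=
  [forall T in Q, majority_ball c T (a T)].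

Definition determines_non_minority (n : nat) (Q : {set {set 'I_n}}) : bool :=
  [forall c : coloring n, forall a : answers n,
     consistent Q a c ==>
     [exists b : 'I_n, forall c' : coloring n,
        consistent Q a c' ==> non_minority c' b]].

Definition solvable_with (n k : nat) : bool :=
  [exists Q : {set {set 'I_n}},
     [&& query_set Q, determines_non_minority Q & #|Q| == k]].

Lemma card_minority n (c : coloring n) :
  0 < n -> 2 * #|[set x | ~~ non_minority c x]| < n.
Proof.
move=> n0; set B := [set x | _].
have [->|[x xB]] := set_0Vmem B; first by rewrite cards0 muln0.
suff /subset_leq_card sB : B \subset [set y | c y == c x].
  by move: xB; rewrite inE /non_minority -ltnNge; apply: leq_trans;
     rewrite ltnS leq_mul2l sB orbT.
apply/subsetP => y yB; rewrite inE; apply/negPn/negP => cyx.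
have eC : [set z | c z == c y] = ~: [set z | c z == c x].
  by apply/setP => z; rewrite !inE; move: cyx; case: (c z) (c y) (c x) => [] [] [].
move: xB yB; rewrite !inE /non_minority -!ltnNge eC => hx hy.
have := cardsC [set z | c z == c x]; rewrite card_ord => e.
by have := leq_add hx hy; rewrite addSn addnS -mulnDr e mul2n -addnn => /ltnW; rewrite ltnn.
Qed.

(* Take a minimal family of consistent colorings whose strict minorities cover
   all balls.  It has at least three members, and three balls private to three
   of these minorities form a triple that has no admissible answer. *)
Lemma all_triples_determine n :
  determines_non_minority [set T : {set 'I_n} | #|T| == 3].
Proof.
set Q := [set T | _].
apply/forallP => c0; apply/forallP => a; apply/implyP => _.
apply: contraT => /existsPn nob.
have n0 : 0 < n by apply: leq_ltn_trans (ltn_ord (a set0)).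
pose B (c : coloring n) := [set x | ~~ non_minority c x].
pose covers (S : {set coloring n}) := (S \subset [set c | consistent Q a c]) &&
  [forall b, exists c in S, b \in B c].
have cov0 : covers [set c | consistent Q a c].
  rewrite /covers subxx; apply/forallP => b.
  have /forallPn[c] := nob b; rewrite negb_imply => /andP[cc mc].
  by apply/existsP; exists c; rewrite !inE cc.
have [S /minsetP[/andP[Scons /forallP Scov] Smin] _] := minset_exists cov0.
have priv c : c \in S -> exists x, (x \in B c) && [forall c' in S, (x \in B c') ==> (c' == c)].
  move=> cS.
  have : ~~ covers (S :\ c).
    apply/negP => /Smin /(_ (subD1set _ _)) e.
    by move: cS; rewrite -e !inE eqxx.
  rewrite /covers (subset_trans (subD1set _ _) Scons) /= => /forallPn[b /existsPn nb].
  have oth c' : c' \in S -> b \in B c' -> c' == c.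
    move=> c'S bc'; apply/negPn/negP => nc.
    by have := nb c'; rewrite in_setD1 nc c'S bc'.
  exists b; apply/andP; split.
    have /existsP[c' /andP[c'S bc']] := Scov b.
    by rewrite -(eqP (oth _ c'S bc')).
  by apply/forallP => c'; apply/implyP => c'S; apply/implyP; exact: oth.
have S3 : 2 < #|S|.
  rewrite ltnNge; apply/negP => S2.
  have cT : [set: 'I_n] \subset \bigcup_(c in S) B c.
    apply/subsetP => b _; have /existsP[c /andP[cS bc]] := Scov b.
    by apply/bigcupP; exists c.
  have := subset_leq_card cT; rewrite cardsT card_ord => le1.
  have le2 : #|\bigcup_(c in S) B c| <= \sum_(c in S) #|B c|.
    elim/big_rec2: _ => [|c m A _ IH]; first by rewrite cards0.
    by apply: leq_trans (leq_card_setU _ _) _; rewrite leq_add2l.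
  have le3 : 2 * \sum_(c in S) #|B c| <= #|S| * n.-1.
    rewrite big_distrr /= -sum_nat_const; apply: leq_sum => c _.
    by rewrite -ltnS prednK // card_minority.
  have : 2 * n <= 2 * n.-1.
    apply: leq_trans (leq_trans le3 _); last by rewrite leq_mul2r S2 orbT.
    by rewrite leq_mul2l (leq_trans le1 le2).
  by rewrite leq_mul2l /= -{1}(prednK n0) ltnn.
have /card_geqP[s [us s3 sS]] := S3.
pose x c := odflt (a set0) [pick x | (x \in B c) && [forall c' in S, (x \in B c') ==> (c' == c)]].
have xP c : c \in S -> (x c \in B c) /\ forall c', c' \in S -> x c \in B c' -> c' = c.
  move=> cS; rewrite /x; case: pickP => [y /andP[yB /forallP yp]|no].
    split=> // c' c'S yc'; apply/eqP.
    by move: (yp c'); rewrite c'S yc'.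
  by have [y] := priv c cS; rewrite no.
have xinj : {in S &, injective x}.
  move=> c c' cS c'S e; apply/esym; apply: (xP c cS).2 => //.
  by rewrite e; apply: (xP c' c'S).1.
pose T := x @: [set c in s].
have T3 : #|T| = 3.
  rewrite card_in_imset ?cardsE; first by rewrite (card_uniqP us).
  by move=> c c'; rewrite !inE => /sS cS /sS c'S; apply: xinj.
have TQ : T \in Q by rewrite inE T3.
have consT c : c \in S -> majority_ball c T (a T).
  move=> cS; have := subsetP Scons c cS; rewrite inE => /forallP /(_ T).
  by rewrite TQ.
have aT : a T \in T.
  have /hasP[c cs _] : has predT s by rewrite has_predT s3.
  by have /andP[] := consT c (sS _ cs).
have /imsetP[c cs ec] := aT; move: cs; rewrite inE => /sS cS.
have /andP[_ /existsP[y /andP[yT /andP[yne /eqP cy]]]] := consT c cS.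
have /imsetP[c' cs' ey] := yT; move: cs'; rewrite inE => /sS c'S.
case/negP: yne; apply/eqP; rewrite ec ey; congr x; apply/esym.
apply: (xP c' c'S).2 => //; have [xB _] := xP c cS.
by move: xB; rewrite -ey -ec !inE /non_minority cy.
Qed.

Lemma solvable_exists n : exists k, solvable_with n k.
Proof.
exists #|[set T : {set 'I_n} | #|T| == 3]|; apply/existsP.
exists [set T : {set 'I_n} | #|T| == 3]; rewrite all_triples_determine eqxx !andbT.
by apply/forallP => T; apply/implyP; rewrite inE.
Qed.

Definition N3 (n : nat) : nat := ex_minn (solvable_exists n).

(* Main.v *)
Require Import Defs.
From mathcomp Require Import all_boot.
From mathcomp Require Import zify.

(** A query set fails exactly when some colorings consistent with common
    answers have strict minorities covering all balls.

    Lower bounds: let X, Y be disjoint blocks of balls of the same size (1 for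
    odd n, 2 for even n) such that few queries meet both.  Averaging provides
    such blocks when there are few queries, and then a set C of nearly half of
    the balls such that no query has one ball in each of X, Y and C.  With A the
    remaining balls, the minorities A + X, A + Y and C cover everything, and
    every query has an answer consistent with all three.

    Upper bound: three balls private to three members of a minimal cover form a
    triple without admissible answer, hence a non-query.  If the non-queries
    contain no complete 4-set, the cover has only three members, so there are at
    least (n + 3)/2 private balls; this is impossible if every pair of balls is
    in at most n/6 non-queries.  The triples of balls with sum 1 modulo 6,
    taken among the first 6 (n %/ 6) balls so that residue classes have equal
    size, have both properties, and their density tends to 1/6. *)

Set Implicit Arguments.
Unset Strict Implicit.
Unset Printing Implicit Defensive.

(** * Double counting of triples and ordered pairs *)

Lemma six_bin3 n : 6 * 'C(n.+2, 3) = n.+2 * n.+1 * n.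
Proof.
have := mul_bin_diag n.+2 2; have := mul_bin_diag n.+1 1; rewrite /= bin1.
nia.
Qed.

Section Triples.

Variable T : finType.
Implicit Types (F : {set {set T}}) (A B X Y : {set T}).

Definition pair_degree F x y := #|[set A in F | (x \in A) && (y \in A)]|.

Lemma set3E A x y z : #|A| = 3 -> x \in A -> y \in A -> z \in A ->
  x != y -> x != z -> y != z -> A = [set x; y; z].
Proof.
move=> A3 xA yA zA xy xz yz; apply/esym/eqP; rewrite eqEcard A3.
have -> : #|[set x; y; z]| = 3.
  by rewrite setUC cardsU1 !inE cards2 xy eq_sym (negPf xz) eq_sym (negPf yz).
by rewrite andbT; apply/subsetP => w; rewrite !inE => /orP[/orP[]|] /eqP->.
Qed.

Lemma card_offdiag A :
  #|[pred p : T * T | [&& p.1 != p.2, p.1 \in A & p.2 \in A]]| = #|A| * #|A|.-1.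
Proof.
have -> : #|[pred p : T * T | [&& p.1 != p.2, p.1 \in A & p.2 \in A]]| =
    \sum_x \sum_(y | [&& x != y, x \in A & y \in A]) 1.
  by rewrite pair_big_dep -sum1_card; apply: eq_bigl.
rewrite (bigID [in A]) /=.
rewrite [X in _ + X]big1 ?addn0 => [|x nx]; last first.
  by apply: big1 => y; rewrite (negPf nx) andbF.
rewrite -sum_nat_const; apply: eq_bigr => x xA.
rewrite (cardsD1 x A) xA add1n -sum1_card.
by apply: eq_bigl => y; rewrite !inE eq_sym.
Qed.

Lemma card_neq_pairs :
  #|[pred p : T * T | p.1 != p.2]| = #|T| * #|T|.-1.
Proof.
rewrite -cardsT -card_offdiag; apply: eq_card => p.
by rewrite !inE !andbT.
Qed.

(** Each triple contains 3 * 2 = 6 ordered pairs of distinct elements; the two summations are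
    exchanged. *)
Lemma sum_pair_degree F : (forall A, A \in F -> #|A| = 3) ->
  \sum_(p : T * T | p.1 != p.2) pair_degree F p.1 p.2 = 6 * #|F|.
Proof.
move=> F3.
under eq_bigr => p _ do rewrite /pair_degree -sum1_card big_mkcond /=.
rewrite exchange_big /= mulnC -sum_nat_const.
rewrite (bigID [in F]) /= [X in _ + X]big1 ?addn0 => [|A nA]; last first.
  by apply: big1 => p _; rewrite inE (negPf nA).
apply: eq_bigr => A AF; under eq_bigr => p _ do rewrite inE AF /=.
rewrite -big_mkcondr /= -[6]/(3 * 3.-1) -(F3 A AF) -card_offdiag -sum1_card.
exact: eq_bigl.
Qed.

Lemma exists_sub_card A m : m <= #|A| -> exists2 B : {set T}, B \subset A & #|B| = m.
Proof.
move=> /card_geqP[s [us sm sA]]; exists [set x in s].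
  by apply/subsetP => x; rewrite inE => /sA.
by rewrite cardsE -sm; apply/card_uniqP.
Qed.

(** The minimum is at most the average. This provides the sparse blocks in both lower bounds. *)
Lemma leq_sum_exists (I : finType) (P : pred I) (f : I -> nat) N :
  0 < #|P| -> \sum_(i | P i) f i <= N ->
  exists2 i, P i & #|P| * f i <= N.
Proof.
move=> /card_gt0P[i0 Pi0] leN; pose i := [arg min_(j < i0 | P j) f j].
have [Pi mini] : P i /\ forall j, P j -> f i <= f j.
  by rewrite /i; case: arg_minnP => // j Pj h.
exists i => //; apply: leq_trans leN; rewrite -sum_nat_const; exact: leq_sum.
Qed.

End Triples.

(** * Lower bounds: query sets defeated by three colorings *)

Section LowerBound.

Variable n : nat.
Implicit Types (Q : {set {set 'I_n}}) (A : {set 'I_n}).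
Implicit Types (b x y z : 'I_n) (c : coloring n).

Lemma majority_ballI c A b x : b \in A -> x \in A -> x != b -> c x = c b ->
  majority_ball c A b.
Proof.
move=> bA xA xb cxb; rewrite /majority_ball bA; apply/existsP; exists x.
by rewrite xA xb cxb eqxx.
Qed.

Lemma minorityE c b : c b -> 2 * #|[set x | c x]| < n -> ~~ non_minority c b.
Proof.
move=> cb; rewrite /non_minority -ltnNge cb; congr (2 * _ < n).
by apply: eq_card => x; rewrite !inE eqb_id.
Qed.

(* A triple has no answer admissible for all three colorings exactly when it
   meets each of the three sets of balls private to one color class. *)
Lemma cover_not_determines Q c1 c2 c3 :
  0 < n -> query_set Q -> (forall x, c3 x = ~~ (c1 x || c2 x)) ->
  2 * #|[set x | c1 x]| < n -> 2 * #|[set x | c2 x]| < n ->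
  2 * #|[set x | c3 x]| < n ->
  (forall A x y z, A \in Q -> x \in A -> y \in A -> z \in A ->
     c1 x && ~~ c2 x -> c2 y && ~~ c1 y -> ~~ c3 z) ->
  ~~ determines_non_minority Q.
Proof.
move=> n0 Q3 c3E m1 m2 m3 notrans.
pose ok A b := [&& majority_ball c1 A b, majority_ball c2 A b & majority_ball c3 A b].
(* The default ball can be reached only on sets outside [Q]. *)
pose a : answers n := [ffun A => odflt (Ordinal n0) [pick b | ok A b]].
have okA A : A \in Q -> ok A (a A).
  move=> AQ; rewrite ffunE; case: pickP => //= no.
  have /forallP /(_ A) := Q3; rewrite AQ /= => /eqP A3.
  have /card_gt2P[x [y [z [[xA yA zA] [xy yz zx]]]]] : 2 < #|A| by rewrite A3.
  have nxyz u v w : u \in A -> v \in A -> w \in A ->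
      [&& c1 u, ~~ c2 u, c2 v & ~~ c1 v] ==> (c1 w || c2 w).
    move=> uA vA wA; apply/implyP => /and4P[u1 u2 v2 v1].
    have := notrans A u v w AQ uA vA wA; rewrite u1 u2 v1 v2 c3E negbK.
    by apply.
  have mj (c : coloring n) u v w : u \in A -> v \in A -> w \in A -> v != u ->
      w != u -> (c v == c u) || (c w == c u) -> majority_ball c A u.
    by move=> uA vA wA vu wu /orP[] /eqP; exact: majority_ballI.
  pose t (c : coloring n) (u v w : 'I_n) := (c v == c u) || (c w == c u).
  have ok3 u v w : u \in A -> v \in A -> w \in A -> v != u -> w != u ->
     [&& t c1 u v w, t c2 u v w & t c3 u v w] -> ok A u.
    move=> uA vA wA vu wu /and3P[t1 t2 t3].
    by apply/and3P; split; apply: (@mj _ u v w).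
  have nt u v w : u \in A -> v \in A -> w \in A -> v != u -> w != u ->
     ~~ [&& t c1 u v w, t c2 u v w & t c3 u v w].
    move=> uA vA wA vu wu; apply/negP => /(ok3 u v w uA vA wA vu wu).
    by rewrite no.
  (* A ball fails as an answer when it is alone in its color in one of the colorings. The values of
     [c1] and [c2] at the three balls leave 64 cases; in each, some ball is admissible or the query
     meets all three private parts. *)
  move: (nt x y z xA yA zA) (nt y x z yA xA zA) (nt z x y zA xA yA).
  rewrite eq_sym xy zx yz [x == z]eq_sym zx [z == y]eq_sym yz.
  move=> /(_ isT isT) + /(_ isT isT) + /(_ isT isT).
  move: (nxyz x y z xA yA zA) (nxyz x z y xA zA yA) (nxyz y x z yA xA zA)
    (nxyz y z x yA zA xA) (nxyz z x y zA xA yA) (nxyz z y x zA yA xA).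
  rewrite /t !c3E.
  by do 6![case: (_ (_ : 'I_n) : bool)].
have cons c : (forall A b, ok A b -> majority_ball c A b) -> consistent Q a c.
  by move=> h; apply/forallP => A; apply/implyP => /okA /h.
have cons1 : consistent Q a c1 by apply: cons => A b /and3P[].
have cons2 : consistent Q a c2 by apply: cons => A b /and3P[].
have cons3 : consistent Q a c3 by apply: cons => A b /and3P[].
apply/negP => /forallP/(_ c1)/forallP/(_ a); rewrite cons1 /=.
case/existsP => b /forallP nb.
have := nb c1; have := nb c2; have := nb c3; rewrite cons1 cons2 cons3 /=.
have := c3E b; case b1: (c1 b) => /=.
  by rewrite (negPf (minorityE b1 m1)).
case b2: (c2 b) => /= b3; first by rewrite (negPf (minorityE b2 m2)).
by rewrite (negPf (minorityE b3 m3)).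
Qed.

(** Here [m] is the size of C, and A + X and A + Y have [n - m - s] balls each. The double sum
    bounds the number of balls that complete a query with a ball of [X] and one of [Y], so the last
    inequality leaves room for C outside these balls and both blocks. *)
Lemma blocks_not_determine Q (X Y : {set 'I_n}) s m :
  query_set Q -> [disjoint X & Y] -> #|X| = s -> #|Y| = s -> 0 < s ->
  2 * m < n -> 2 * (n - m - s) < n ->
  \sum_(x in X) \sum_(y in Y) pair_degree Q x y + m + 2 * s <= n ->
  ~~ determines_non_minority Q.
Proof.
move=> Q3 dXY Xs Ys s0 mn msn degn.
have Qcard A : A \in Q -> #|A| = 3.
  by move=> AQ; have /forallP /(_ A) := Q3; rewrite AQ /= => /eqP.
have n0 : 0 < n by lia.
pose E := [set z | [exists x in X, exists y in Y,
  [&& z != x, z != y & [set x; y; z] \in Q]]].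
have Ele : #|E| <= \sum_(x in X) \sum_(y in Y) pair_degree Q x y.
  pose Exy x y := [set z | [&& z != x, z != y & [set x; y; z] \in Q]].
  have sE : E \subset \bigcup_(x in X) \bigcup_(y in Y) Exy x y.
    apply/subsetP => z; rewrite inE => /existsP[x /andP[xX /existsP[y /andP[yY h]]]].
    by apply/bigcupP; exists x => //; apply/bigcupP; exists y => //; rewrite inE.
  have bc (Z : {set 'I_n}) (f : 'I_n -> {set 'I_n}) :
      #|\bigcup_(x in Z) f x| <= \sum_(x in Z) #|f x|.
    elim/big_rec2: _ => [|x k A _ IH]; first by rewrite cards0.
    by apply: leq_trans (leq_card_setU _ _) _; rewrite leq_add2l.
  apply: leq_trans (subset_leq_card sE) _; apply: leq_trans (bc _ _) _.
  apply: leq_sum => x xX; apply: leq_trans (bc _ _) _.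
  apply: leq_sum => y yY; rewrite /pair_degree.
  have inj : {in Exy x y &, injective (fun z => [set x; y; z])}.
    move=> z z'; rewrite !inE => /and3P[zx zy _] _ /setP/(_ z).
    by rewrite !inE (negPf zx) (negPf zy) eqxx /= => /esym/eqP.
  rewrite -(card_in_imset inj); apply: subset_leq_card.
  apply/subsetP => A /imsetP[z]; rewrite inE => /and3P[_ _ h] ->.
  by rewrite !inE h !eqxx orbT.
have XYc : #|X :|: Y| = 2 * s by rewrite cardsU (disjoint_setI0 dXY) cards0 Xs Ys; lia.
have [C sC Cm] : exists2 C : {set 'I_n}, C \subset ~: (X :|: Y :|: E) & #|C| = m.
  apply: exists_sub_card.
  have := cardsC (X :|: Y :|: E); rewrite card_ord.
  have : #|X :|: Y :|: E| <= #|X :|: Y| + #|E| by rewrite leq_card_setU.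
  lia.
have CX z : z \in C -> [/\ z \notin X, z \notin Y & z \notin E].
  by move/(subsetP sC); rewrite in_setC in_setU in_setU !negb_or => /andP[/andP[]].
have XnY z : z \in X -> z \notin Y by move/(disjointFr dXY) => ->.
have cardD (Z W : {set 'I_n}) : W = ~: (C :|: Z) -> #|Z| = s ->
    (forall z, z \in C -> z \notin Z) -> 2 * #|W| < n.
  move=> -> Zs CZ; have := cardsC (C :|: Z); rewrite card_ord cardsU Cm Zs.
  have -> : C :&: Z = set0.
    by apply/setP => z; rewrite !inE; apply/negP => /andP[/CZ/negP].
  rewrite cards0; lia.
(* The color [true] marks A + X in [c1], A + Y in [c2] and C in [c3]. The private parts are [X], [Y]
   and [C], so a query meeting all three would put its ball of [C] in [E]. *)
pose c1 : coloring n := [ffun z => (z \notin C) && (z \notin Y)].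
pose c2 : coloring n := [ffun z => (z \notin C) && (z \notin X)].
pose c3 : coloring n := [ffun z => z \in C].
apply: (@cover_not_determines Q c1 c2 c3) => //.
- move=> z; rewrite !ffunE; case: (z \in C) => //=.
  by case zX: (z \in X); rewrite ?orbT //= XnY.
- apply: (cardD Y) => //; first by apply/setP => z; rewrite !inE ffunE negb_or.
  by move=> z /CX[].
- apply: (cardD X) => //; first by apply/setP => z; rewrite !inE ffunE negb_or.
  by move=> z /CX[].
- by rewrite (_ : [set x | _] = C) ?Cm //; apply/setP => z; rewrite inE ffunE.
move=> A x y z AQ xA yA zA; rewrite !ffunE.
case xC: (x \in C) => //=; rewrite negbK => /andP[xY xX].
case yC: (y \in C) => //=; rewrite negbK => /andP[yX yY].
apply/negP => zC; have [zX zY] := CX _ zC; rewrite inE => /negP[].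
have nzx : z != x by apply: contraNneq zX => ->.
have nzy : z != y by apply: contraNneq zY => ->.
apply/existsP; exists x; rewrite xX; apply/existsP; exists y; rewrite yY /= nzx nzy.
rewrite -(set3E (Qcard _ AQ)) // 1?eq_sym //.
by apply: contraNneq xY => <-.
Qed.

End LowerBound.

(** If 2 |Q| < C(n, 3), averaging gives two balls of pair degree below (n - 2) / 2; they serve as
    one-ball blocks. *)
Lemma determines_card_odd n (Q : {set {set 'I_n}}) : odd n -> query_set Q ->
  determines_non_minority Q -> 'C(n, 3) <= 2 * #|Q|.
Proof.
move=> on Q3 dQ; case: n on Q Q3 dQ => [|[|j]] // on Q Q3 dQ.
rewrite leqNgt; apply: contraL dQ => small.
have Qcard A : A \in Q -> #|A| = 3.
  by move=> AQ; have /forallP /(_ A) := Q3; rewrite AQ /= => /eqP.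
have Tn : #|[pred p : 'I_j.+2 * 'I_j.+2 | p.1 != p.2]| = j.+2 * j.+1.
  by rewrite card_neq_pairs card_ord.
have [||[x y] /= xy] := @leq_sum_exists _ (fun p : 'I_j.+2 * 'I_j.+2 => p.1 != p.2)
  (fun p => pair_degree Q p.1 p.2) (6 * #|Q|).
- by rewrite Tn.
- by rewrite sum_pair_degree.
rewrite [X in X * _]Tn => deg.
have deg2 : 2 * pair_degree Q x y < j.
  rewrite -(@ltn_pmul2l (j.+2 * j.+1)) // mulnCA.
  by have := six_bin3 j; move: (_ * pair_degree _ _ _) #|Q| small deg => d q; lia.
(* With |C| = (n - 1) / 2, all three minorities have the largest possible size (n - 1) / 2. *)
apply: (@blocks_not_determine _ Q [set x] [set y] 1 j.+2./2) => //.
- by rewrite disjoints1 inE.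
- by rewrite cards1.
- by rewrite cards1.
- by have := odd_double_half j.+2; lia.
- by have := odd_double_half j.+2; lia.
by rewrite !big_set1; have := odd_double_half j.+2; lia.
Qed.

(** Since 6 C(2k - 2, 3) = 4 (k - 1) (k - 2) (2k - 3), the hypotheses give d < (k - 2) (2k - 3) /
    (2k) < k - 2. *)
Lemma block_degree_bound k d q : 2 < k -> k * k.-1 * d <= 6 * q ->
  8 * q < 'C(k.*2 - 2, 3) -> d < k - 2.
Proof.
case: k => [|[|[|l]]] //= _ deg; rewrite (_ : l.+3.*2 - 2 = l.*2.+4); last by lia.
move=> small; rewrite ltnNge; apply/negP => dl; have := six_bin3 l.*2.+2.
have : l.+3 * l.+2 * l.+1 <= l.+3 * l.+2 * d by rewrite leq_mul2l; lia.
nia.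
Qed.

(** For n = 2k a strict minority has at most k - 1 balls. As |A| + s and |C| are at most k - 1 while
    |A| + 2s + |C| = 2k, the block size s must be at least 2. *)
Lemma determines_card_even n (Q : {set {set 'I_n}}) : ~~ odd n -> query_set Q ->
  determines_non_minority Q -> 'C(n - 2, 3) <= 8 * #|Q|.
Proof.
move=> en Q3 dQ.
have nE := even_halfK en; set k := n./2 in nE.
case: (ltnP k 3) => [k3|k3]; first by rewrite bin_small //; lia.
rewrite leqNgt; apply: contraL dQ => small.
have Qcard A : A \in Q -> #|A| = 3.
  by move=> AQ; have /forallP /(_ A) := Q3; rewrite AQ /= => /eqP.
(* The blocks are the k pairs {2i, 2i + 1}. *)
have half_ltk (x : 'I_n) : x./2 < k by rewrite ltn_half_double nE.
pose pi x := Ordinal (half_ltk x).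
pose X i := [set x | pi x == i].
have Xcard i : #|X i| = 2.
  have lt0 : i.*2 < n by rewrite -nE ltn_double.
  have lt1 : i.*2.+1 < n by rewrite -nE ltn_Sdouble.
  have -> : X i = [set Ordinal lt0; Ordinal lt1].
    by apply/setP => x; rewrite !inE -!val_eqE /=; have := odd_double_half x; lia.
  by rewrite cards2 -val_eqE /=; lia.
have Tk : #|[pred p : 'I_k * 'I_k | p.1 != p.2]| = k * k.-1.
  by rewrite card_neq_pairs card_ord.
have [||[i j] /= ij] := @leq_sum_exists _ (fun p : 'I_k * 'I_k => p.1 != p.2)
  (fun p => \sum_(x in X p.1) \sum_(y in X p.2) pair_degree Q x y) (6 * #|Q|).
- by rewrite [X in 0 < X]Tk muln_gt0; lia.
- rewrite -sum_pair_degree //.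
  (* Pairs of balls within one block are dropped; the others are grouped by their pair of blocks. *)
  rewrite [leqRHS](bigID (fun p => pi p.1 != pi p.2)) /=.
  apply: leq_trans (leq_addr _ _).
  rewrite (partition_big (fun p => (pi p.1, pi p.2)) (fun p => p.1 != p.2)) /=;
    last first.
    by move=> p /andP[].
  apply: leq_sum => -[i j] /= ij; rewrite pair_big /= leq_eqVlt; apply/orP; left.
  apply/eqP/eq_bigl => -[x y] /=; rewrite !inE xpair_eqE.
  case: (boolP (_ && _)) => [/andP[/eqP xi /eqP yj]|]; last by rewrite andbF.
  by rewrite xi yj ij !andbT; apply/esym; apply: contraNneq ij => e; rewrite -xi -yj e.
rewrite [X in X * _]Tk => deg.
have {}deg : \sum_(x in X i) \sum_(y in X j) pair_degree Q x y < k - 2.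
  by apply: block_degree_bound k3 deg _; rewrite nE.
apply: (@blocks_not_determine _ Q (X i) (X j) 2 k.-1) => //; try lia.
  rewrite -setI_eq0; apply/eqP/setP => x; rewrite !inE.
  by apply/negP => /andP[/eqP -> /eqP e]; rewrite e eqxx in ij.
by move: (\sum_(x in _) _) deg => d; lia.
Qed.

(** * Upper bound: private balls of a minimal cover *)

Section UpperBound.

Variable n : nat.
Implicit Types (H Q : {set {set 'I_n}}) (S : {set coloring n}).
Implicit Types (A : {set 'I_n}) (b x y z w : 'I_n) (c : coloring n).

Definition minority c := [set x | ~~ non_minority c x].

Lemma minority_eq_color c x y : x \in minority c -> c y = c x -> y \in minority c.
Proof. by rewrite !inE /non_minority => + ->. Qed.

Definition private_balls S c :=
  [set x in minority c | [forall c' in S, (x \in minority c') ==> (c' == c)]].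

Lemma private_ballsP S c x c' :
  x \in private_balls S c -> c' \in S -> x \in minority c' -> c' = c.
Proof.
by rewrite inE => /andP[_ /forallP/(_ c')] /implyP h /h /implyP {}h /h /eqP.
Qed.

(** If [Q] fails, the minorities of all colorings consistent with some answers cover the balls. In
    an inclusion-minimal subcover, a member without a private ball could be removed. *)
Lemma minimal_minority_cover Q : ~~ determines_non_minority Q ->
  exists (a : answers n) (S : {set coloring n}),
  [/\ forall c, c \in S -> consistent Q a c,
      forall x, exists2 c, c \in S & x \in minority c
    & forall c, c \in S -> exists x, x \in private_balls S c].
Proof.
move=> /forallPn[c0 /forallPn[a]]; rewrite negb_imply => /andP[_ /existsPn nob].
pose covers (S : {set coloring n}) := (S \subset [set c | consistent Q a c]) &&
  [forall b, exists c in S, b \in minority c].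
have cov0 : covers [set c | consistent Q a c].
  rewrite /covers subxx; apply/forallP => b.
  have /forallPn[c] := nob b; rewrite negb_imply => /andP[cc mc].
  by apply/existsP; exists c; rewrite !inE cc.
have [S /minsetP[/andP[Scons /forallP Scov] Smin] _] := minset_exists cov0.
exists a, S; split.
- by move=> c /(subsetP Scons); rewrite inE.
- by move=> x; have /existsP[c /andP[]] := Scov x; exists c.
move=> c cS.
have : ~~ covers (S :\ c).
  by apply: contraL cS => /Smin /(_ (subD1set _ _)) <-; rewrite !inE eqxx.
rewrite /covers (subset_trans (subD1set _ _) Scons) /= => /forallPn[b /existsPn nb].
have oth c' : c' \in S -> b \in minority c' -> c' == c.
  move=> c'S bc'; apply/negPn/negP => nc.
  by have := nb c'; rewrite in_setD1 nc c'S bc'.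
exists b; rewrite inE; apply/andP; split.
  have /existsP[c' /andP[c'S bc']] := Scov b.
  by rewrite -(eqP (oth _ c'S bc')).
by apply/forallP => c'; apply/implyP => c'S; apply/implyP; exact: oth.
Qed.

(** A minority contains the whole color class of each of its balls. So under [c1] neither [x2] nor
    [x3] shares the color of [x1], which is thus not an admissible answer; the same holds for the
    other two. *)
Lemma private_triple Q a S c1 c2 c3 x1 x2 x3 :
  (forall c, c \in S -> consistent Q a c) ->
  c1 \in S -> c2 \in S -> c3 \in S -> c1 != c2 -> c1 != c3 -> c2 != c3 ->
  x1 \in private_balls S c1 -> x2 \in private_balls S c2 ->
  x3 \in private_balls S c3 ->
  [/\ x1 != x2, x1 != x3, x2 != x3 & [set x1; x2; x3] \notin Q].
Proof.
move=> cons S1 S2 S3 n12 n13 n23 p1 p2 p3.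
have mem c x : x \in private_balls S c -> x \in minority c by rewrite inE => /andP[].
have sep c c' x x' : c \in S -> c' \in S -> c != c' ->
    x \in private_balls S c -> x' \in private_balls S c' -> c x' != c x.
  move=> cS c'S ncc' px px'; apply: contra ncc' => /eqP e; apply/eqP.
  by apply: private_ballsP px' _ _ => //; apply: minority_eq_color e; exact: mem.
have neq c c' x x' : c \in S -> c' \in S -> c != c' ->
    x \in private_balls S c -> x' \in private_balls S c' -> x != x'.
  move=> cS c'S ncc' px px'; apply: contraNneq (sep _ _ _ _ cS c'S ncc' px px').
  by move=> ->.
split; [exact: (neq c1 c2)|exact: (neq c1 c3)|exact: (neq c2 c3)|].
apply/negP => AQ; set A := [set x1; x2; x3] in AQ.
have maj c : c \in S -> majority_ball c A (a A).
  by move=> /cons /forallP /(_ A); rewrite AQ.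
have n21 : c2 != c1 by rewrite eq_sym.
have n31 : c3 != c1 by rewrite eq_sym.
have n32 : c3 != c2 by rewrite eq_sym.
have alone c x : c \in S -> a A = x ->
    (forall y, y \in A -> y != x -> c y != c x) -> False.
  move=> cS ax h; have /andP[_ /existsP[y /and3P[yA yx cy]]] := maj c cS.
  by rewrite ax in yx cy; have := h y yA yx; rewrite cy.
have /andP[aA _] := maj _ S1.
have {}alone c x : c \in S -> a A = x ->
    (forall y, y \in [:: x1; x2; x3] -> y != x -> c y != c x) -> False.
  move=> cS ax h; apply: (alone c x cS ax) => y yA; apply: h.
  by move: yA; rewrite !inE orbA.
have : a A \in [:: x1; x2; x3] by move: aA; rewrite !inE orbA.
rewrite !inE => /or3P[] /eqP e.
- apply: (alone c1 x1) => // y; rewrite !inE => /or3P[] /eqP->;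
    rewrite ?eqxx // => _; [exact: (sep c1 c2)|exact: (sep c1 c3)].
- apply: (alone c2 x2) => // y; rewrite !inE => /or3P[] /eqP->;
    rewrite ?eqxx // => _; [exact: (sep c2 c1)|exact: (sep c2 c3)].
- apply: (alone c3 x3) => // y; rewrite !inE => /or3P[] /eqP->;
    rewrite ?eqxx // => _; [exact: (sep c3 c1)|exact: (sep c3 c2)].
Qed.

(** [H] is the set of non-queries. Four members of a minimal cover would yield four private balls
    with all their triples in [H]; three members are excluded by counting. *)
Lemma sparse_complement_determines H u : 6 * u <= n ->
  (forall x y z w, x != y -> x != z -> x != w -> y != z -> y != w -> z != w ->
     [set x; y; z] \in H -> [set x; y; w] \in H -> [set x; z; w] \in H ->
     [set y; z; w] \notin H) ->
  (forall x y, x != y ->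
     #|[set z | [&& z != x, z != y & [set x; y; z] \in H]]| <= u) ->
  determines_non_minority ([set A : {set 'I_n} | #|A| == 3] :\: H).
Proof.
move=> un noK4 codeg; apply: contraT => nd.
have n0 : 0 < n.
  move: nd => /forallPn[c0 /forallPn[a _]]; exact: leq_ltn_trans (ltn_ord (a set0)).
have [a [S [cons cov priv]]] := minimal_minority_cover nd.
have triple c1 c2 c3 x1 x2 x3 :
  c1 \in S -> c2 \in S -> c3 \in S -> c1 != c2 -> c1 != c3 -> c2 != c3 ->
  x1 \in private_balls S c1 -> x2 \in private_balls S c2 ->
  x3 \in private_balls S c3 ->
  [/\ x1 != x2, x1 != x3, x2 != x3 & [set x1; x2; x3] \in H].
  move=> S1 S2 S3 n12 n13 n23 p1 p2 p3.
  have [x12 x13 x23] := private_triple cons S1 S2 S3 n12 n13 n23 p1 p2 p3.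
  have A3 : #|[set x1; x2; x3]| = 3.
    by rewrite setUC cardsU1 !inE cards2 x12 eq_sym (negPf x13) eq_sym (negPf x23).
  by rewrite in_setD inE A3 eqxx andbT negbK.
have [S4|S3] := ltnP 3 #|S|.
  have /card_geqP[s [us s4 sS]] := S4.
  case: s us s4 sS => [|c1 [|c2 [|c3 [|c4 []]]]] // us _ sS.
  have [S1 S2 S3 S4'] : [/\ c1 \in S, c2 \in S, c3 \in S & c4 \in S].
    by split; apply: sS; rewrite !inE eqxx ?orbT.
  move: us; rewrite /= !inE !negb_or => /and4P[/and3P[n12 n13 n14] /andP[n23 n24] n34 _].
  have [x1 p1] := priv _ S1; have [x2 p2] := priv _ S2.
  have [x3 p3] := priv _ S3; have [x4 p4] := priv _ S4'.
  have [x12 x13 x23 h123] := triple _ _ _ _ _ _ S1 S2 S3 n12 n13 n23 p1 p2 p3.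
  have [_ x14 x24 h124] := triple _ _ _ _ _ _ S1 S2 S4' n12 n14 n24 p1 p2 p4.
  have [_ _ x34 h134] := triple _ _ _ _ _ _ S1 S3 S4' n13 n14 n34 p1 p3 p4.
  have [_ _ _ h234] := triple _ _ _ _ _ _ S2 S3 S4' n23 n24 n34 p2 p3 p4.
  by have := noK4 _ _ _ _ x12 x13 x14 x23 x24 x34 h123 h124 h134; rewrite h234.
(* Each ball is counted at least twice, as a ball of two minorities or as a
   private ball of one. *)
have twice : 2 * n <= \sum_(c in S) (#|minority c| + #|private_balls S c|).
  have cardE (A : {set 'I_n}) : #|A| = \sum_x (x \in A).
    by rewrite -sum1_card big_mkcond; apply: eq_bigr => x _; case: (x \in A).
  under eq_bigr => c _ do rewrite !cardE -big_split /=.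
  rewrite exchange_big /= mulnC -{1}[n]card_ord -sum_nat_const.
  apply: leq_sum => x _; have [c cS xc] := cov x.
  rewrite (bigD1 c) //= xc.
  have [xp|] := boolP (x \in private_balls S c); first by rewrite leq_addr.
  rewrite inE xc /= => /forallPn[c']; rewrite !negb_imply => /and3P[c'S xc' cc'].
  by rewrite (bigD1 c') ?c'S //= xc'; lia.
have small c : c \in S -> 2 * #|minority c| <= n.-1.
  by move=> _; rewrite -ltnS prednK // card_minority.
(* Two sets of fewer than n / 2 balls cannot cover all balls. *)
have S2 : 2 < #|S|.
  rewrite ltnNge; apply/negP => S2.
  have : n <= \sum_(c in S) #|minority c|.
    rewrite -{1}[n]card_ord -cardsT.
    apply: leq_trans (_ : #|\bigcup_(c in S) minority c| <= _).
      apply/subset_leq_card/subsetP => x _; have [c cS xc] := cov x.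
      by apply/bigcupP; exists c.
    elim/big_rec2: _ => [|c m A _ IH]; first by rewrite cards0.
    by apply: leq_trans (leq_card_setU _ _) _; rewrite leq_add2l.
  have : \sum_(c in S) 2 * #|minority c| <= \sum_(c in S) n.-1 by apply: leq_sum.
  rewrite sum_nat_const -big_distrr /=.
  have : #|S| * n.-1 <= 2 * n.-1 by rewrite leq_mul2r S2 orbT.
  move: (#|S| * n.-1) (\sum_(c in S) _) => p q; lia.
(* Fix private balls [x1], [x2] of two other members: every private ball of [c] completes them to a
   triple of [H]. *)
have privle c : c \in S -> #|private_balls S c| <= u.
  move=> cS; have : 1 < #|S :\ c| by move: S2; rewrite (cardsD1 c S) cS add1n ltnS.
  case/card_gt1P => c1 [c2 []]; rewrite !inE => /andP[n1 S1] /andP[n2 S2'] n12.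
  have [x1 p1] := priv _ S1; have [x2 p2] := priv _ S2'.
  have [x p] := priv _ cS.
  have [x12 _ _ _] := triple _ _ _ _ _ _ S1 S2' cS n12 n1 n2 p1 p2 p.
  apply: leq_trans (codeg _ _ x12); apply/subset_leq_card/subsetP => y py.
  have [_ ? ? h] := triple _ _ _ _ _ _ S1 S2' cS n12 n1 n2 p1 p2 py.
  by rewrite inE h eq_sym andbT eq_sym; apply/andP; split; rewrite eq_sym.
(* With three members, 4n <= 3 (n - 1) + 6u, contradicting 6u <= n. *)
have : \sum_(c in S) 2 * (#|minority c| + #|private_balls S c|) <=
    \sum_(c in S) (n.-1 + 2 * u).
  apply: leq_sum => c cS; have := small _ cS; have := privle _ cS; lia.
rewrite sum_nat_const -big_distrr /=.
have -> : #|S| = 3 by apply/eqP; rewrite eqn_leq S3.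
by move: (\sum_(c in S) _) twice => p; lia.
Qed.

End UpperBound.

(** * Non-queries from residues modulo 6 *)

Section ResidueTriples.

Variables n u : nat.
Implicit Types (A : {set 'I_n}) (x y z : 'I_n).

Definition residue_triples : {set {set 'I_n}} :=
  [set A : {set 'I_n} | [&& #|A| == 3, A \subset [set x : 'I_n | x < 6 * u]
                  & (\sum_(x in A) x) %% 6 == 1]].

Lemma residue_triplesE x y z : x != y -> x != z -> y != z ->
  ([set x; y; z] \in residue_triples) =
  [&& x < 6 * u, y < 6 * u, z < 6 * u & (x + y + z) %% 6 == 1].
Proof.
move=> xy xz yz.
have zn : z \notin [set x; y] by rewrite !inE negb_or eq_sym xz eq_sym yz.
have xn : x \notin [set y] by rewrite inE.
rewrite inE setUC cardsU1 zn cards2 xy eqxx /= big_setU1 // big_setU1 // big_set1 /=.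
rewrite !subUset !sub1set !inE [z + _]addnC.
by case: (x < _); case: (y < _); case: (z < _).
Qed.

Definition residue_class r := [set z : 'I_n | (z < 6 * u) && (z %% 6 == r)].

Lemma card_residue_class r : 6 * u <= n -> r < 6 -> #|residue_class r| = u.
Proof.
move=> un r6; have fP (i : 'I_u) : 6 * i + r < n by have := ltn_ord i; lia.
have -> : residue_class r = [set Ordinal (fP i) | i in 'I_u].
  apply/setP => z; rewrite inE; apply/andP/imsetP => [[zu /eqP zr]|[i _ ->] /=].
    have zu6 : z %/ 6 < u by lia.
    by exists (Ordinal zu6) => //; apply: val_inj => /=; lia.
  by have := ltn_ord i; split; lia.
rewrite card_imset ?card_ord // => i j /(congr1 val) /= e; apply: val_inj => /=; lia.
Qed.

(* The four congruences add up to 3 (x + y + z + w) = 4 modulo 6. *)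
Lemma residue_triples_K4_free x y z w :
  x != y -> x != z -> x != w -> y != z -> y != w -> z != w ->
  [set x; y; z] \in residue_triples -> [set x; y; w] \in residue_triples ->
  [set x; z; w] \in residue_triples -> [set y; z; w] \notin residue_triples.
Proof.
move=> xy xz xw yz yw zw; rewrite !residue_triplesE //.
move=> /and4P[_ _ _ /eqP h1] /and4P[_ _ _ /eqP h2] /and4P[_ _ _ /eqP h3].
by apply/negP => /and4P[_ _ _ /eqP h4]; lia.
Qed.

Lemma residue_triples_codegree x y : 6 * u <= n -> x != y ->
  #|[set z | [&& z != x, z != y & [set x; y; z] \in residue_triples]]| <= u.
Proof.
move=> un xy.
(* The third ball has residue 1 - x - y; writing 7 for 1 keeps the subtraction from truncating. *)
rewrite -[leqRHS](@card_residue_class ((7 - (x + y) %% 6) %% 6)) ?ltn_mod //.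
apply/subset_leq_card/subsetP => z; rewrite inE => /and3P[zx zy].
rewrite residue_triplesE // 1?eq_sym //.
by move=> /and4P[_ _ zu /eqP]; rewrite inE zu /=; lia.
Qed.

(** All [u] balls of the required residue complete the pair, except possibly [x] and [y]
    themselves. *)
Lemma residue_triples_pair_degree x y : 6 * u <= n -> x != y ->
  x < 6 * u -> y < 6 * u ->
  u - 2 <= pair_degree residue_triples x y.
Proof.
move=> un xy xu yu; pose r := (7 - (x + y) %% 6) %% 6.
pose D := residue_class r :\: [set x; y].
have Dcard : u - 2 <= #|D|.
  rewrite cardsD card_residue_class ?ltn_mod //; apply: leq_sub2l.
  apply: leq_trans (subset_leq_card (subsetIr _ _)) _.
  by rewrite cards2; case: (_ != _).
apply: leq_trans Dcard _.
have inj : {in D &, injective (fun z => [set x; y; z])}.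
  move=> z z'; rewrite !inE negb_or => /andP[/andP[zx zy] _] _ /setP/(_ z).
  by rewrite !inE (negPf zx) (negPf zy) eqxx /= => /esym/eqP.
rewrite -(card_in_imset inj); apply/subset_leq_card/subsetP => A /imsetP[z].
rewrite !in_setD in_set2 negb_or inE => /andP[/andP[zx zy] /andP[zu /eqP zr]] ->.
rewrite inE residue_triplesE // 1?eq_sym // xu yu zu !inE !eqxx orbT /= andbT.
by move: zr; rewrite /r; lia.
Qed.

Lemma card_residue_triples : 6 * u <= n ->
  6 * u * (6 * u).-1 * (u - 2) <= 6 * #|residue_triples|.
Proof.
move=> un; rewrite -sum_pair_degree; last by move=> A; rewrite inE => /and3P[/eqP].
pose V := [set x : 'I_n | x < 6 * u].
have cV : #|V| = 6 * u.
  have -> : V = [set widen_ord un i | i in 'I_(6 * u)].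
    apply/setP => x; rewrite inE; apply/idP/imsetP => [xu|[i _ ->] //=].
    by exists (Ordinal xu) => //; apply: val_inj.
  by rewrite card_imset ?card_ord // => i j /(congr1 val) /= /val_inj.
rewrite -{1 2}cV -card_offdiag -sum_nat_const.
rewrite [leqRHS](bigID (fun p => (p.1 \in V) && (p.2 \in V))) /=.
apply: leq_trans (leq_addr _ _); apply: leq_sum => -[x y] /=.
by rewrite !inE /= => /and3P[xy xu yu]; apply: residue_triples_pair_degree.
Qed.

End ResidueTriples.

(** * Bounds on [N3] in natural numbers *)

Lemma N3_bin_odd n : odd n -> 'C(n, 3) <= 2 * N3 n.
Proof.
move=> on; rewrite /N3; case: ex_minnP => k /existsP[Q /and3P[Q3 dQ /eqP <-]] _.
exact: determines_card_odd.
Qed.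

Lemma N3_bin_even n : ~~ odd n -> 'C(n - 2, 3) <= 8 * N3 n.
Proof.
move=> en; rewrite /N3; case: ex_minnP => k /existsP[Q /and3P[Q3 dQ /eqP <-]] _.
exact: determines_card_even.
Qed.

Lemma N3_upper_bound n u : 6 * u <= n ->
  6 * N3 n + 6 * u * (6 * u).-1 * (u - 2) <= 6 * 'C(n, 3).
Proof.
move=> un; set H := residue_triples n u; set Q := [set A : {set 'I_n} | #|A| == 3] :\: H.
have QH : #|Q| + #|H| = 'C(n, 3).
  have := cardsID H [set A : {set 'I_n} | #|A| == 3].
  rewrite (setIidPr _) ?card_draws ?card_ord 1?addnC //.
  by apply/subsetP => A; rewrite !inE => /and3P[].
have : N3 n <= #|Q|.
  rewrite /N3; case: ex_minnP => k _; apply; apply/existsP; exists Q.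
  rewrite eqxx andbT; apply/andP; split.
    by apply/forallP => A; apply/implyP; rewrite in_setD => /andP[_]; rewrite inE.
  apply: (sparse_complement_determines un).
    exact: residue_triples_K4_free.
  by move=> x y; apply: residue_triples_codegree.
have := card_residue_triples un; rewrite -/H; move: (N3 n) => N.
move: #|Q| #|H| QH => q h; lia.
Qed.

(** As 6u >= m - 5, the product on the right is at least (m - 5) (m - 6) (m - 17) for large m. The
    loss is about 25 m^2, and 600 leaves ample room; for m <= 600 the error term alone suffices. *)
Lemma residue_count_bound m u : m <= 6 * u + 5 ->
  m * m.-1 * m.-2 <= 600 * (m.-1 * m.-2) + 6 * (6 * u * (6 * u).-1 * (u - 2)).
Proof.
move=> mu; have [m600|m600] := leqP m 600.
  by apply: leq_trans (leq_addr _ _); rewrite -mulnA leq_mul2r m600 orbT.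
have [t mE] : exists t, m = t + 600 by exists (m - 600); lia.
have -> : 6 * (6 * u * (6 * u).-1 * (u - 2)) = 6 * u * (6 * u).-1 * (6 * u - 12).
  by rewrite mulnCA (_ : 6 * u - 12 = 6 * (u - 2)) //; lia.
have : (t + 595) * (t + 594) * (t + 583) <= 6 * u * (6 * u).-1 * (6 * u - 12).
  by rewrite !leq_mul //; lia.
move: (_ * (6 * u - 12)) => w; subst m.
rewrite (_ : (t + 600).-1 = t + 599); last by lia.
rewrite (_ : (t + 599).-1 = t + 598); last by lia.
nia.
Qed.

(** For n > 0 this reads N3(n) <= (5/6 + 100/n) C(n, 3). *)
Lemma N3_upper n : 6 * n * N3 n <= (5 * n + 600) * 'C(n, 3).
Proof.
case: n => [|[|n]]; first by rewrite muln0.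
  by have := @N3_upper_bound 1 0 isT; lia.
have un : 6 * (n.+2 %/ 6) <= n.+2 by lia.
have := N3_upper_bound un; have := six_bin3 n.
have /residue_count_bound : n.+2 <= 6 * (n.+2 %/ 6) + 5 by lia.
move: (_ * (_ - 2)) (N3 n.+2) 'C(n.+2, 3) => w N C /= bw C6 bN.
(* Multiplying by the number of balls turns the quadratic error term into a multiple of the
   binomial. *)
have bC : n.+2 * C <= 600 * C + n.+2 * w.
  rewrite -(@leq_pmul2l 6) // mulnCA C6.
  have := leq_mul (leqnn n.+2) bw; nia.
have := leq_mul (leqnn n.+2) bN; nia.
Qed.

(* Real-valued bounds and the limit *)
From mathcomp Require Import all_boot all_order all_algebra.
From mathcomp Require Import all_classical all_reals all_analysis.
From mathcomp Require Import lra.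
Import Order.TTheory GRing.Theory Num.Theory.
Import numFieldNormedType.Exports.
Local Open Scope classical_set_scope.
Local Open Scope ring_scope.

Theorem theorem4 (R : realType) :
  [/\ forall n : nat, odd n -> 1 / 2 * ('C(n, 3))%:R <= (N3 n)%:R :> R,
      forall n : nat, ~~ odd n -> 1 / 8 * ('C(n - 2, 3))%:R <= (N3 n)%:R :> R
    & exists2 o : nat -> R, o @ \oo --> (0 : R)
        & \forall n \near \oo, (N3 n)%:R <= (5 / 6 + o n) * ('C(n, 3))%:R].
Proof.
split.
- move=> n /N3_bin_odd; rewrite -(ler_nat R) natrM; lra.
- move=> n /N3_bin_even; rewrite -(ler_nat R) natrM; lra.
(* [harmonic n] is 1 / (n + 1), and 200 / (n + 1) >= 100 / n for n >= 1. *)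
exists (fun n => 200 * harmonic n).
  by rewrite -(mulr0 200); apply: cvgM; [exact: cvg_cst|exact: cvg_harmonic].
near=> n; have n0 : (0 < n)%N by near: n; exact: nbhs_infty_gt.
have := N3_upper n; rewrite -(ler_nat R) !natrM natrD natrM /harmonic /=.
have : 1 <= n%:R :> R by rewrite ler1n.
have : n.+1%:R^-1 * (n%:R + 1) = 1 :> R by rewrite -natr1 mulVf // natr1.
move: n%:R n.+1%:R^-1 (N3 n)%:R => m h N mh m1 bN.
have C0 : 0 <= 'C(n, 3)%:R :> R by [].
move: 'C(n, 3)%:R C0 bN => C C0 bN.
have mh2 : 1 <= 2 * (m * h) by nra.
have mhC : C <= 2 * (m * h) * C by rewrite ler_peMl.
rewrite -(@ler_pM2l _ (6 * m)); last by lra.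
apply: le_trans bN _; lra.
Unshelve. all: by end_near. Qed.
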